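(* Consider the problem $$\min_{x_1,\dots,x_n}\ f(x)=\sum_{i=1}^n f_i(x_i)\quad\text{s.t.}\quad \sum_{i=1}^n \mathcal{A}_i(x_i)=b ,$$ let $(x_1^*,\dots,x_n^*,\lambda^* )$ be a KKT point of it, $x^*=(x_1^*,\dots,x_n^* )$, and let $\{(x^k,\lambda^k)\}$, $x^k=(x_1^k,\dots,x_n^k)$, be generated by LADMPSAP with $\eta_i>n\|\mathcal{A}_i\|^2$, $i=1,\dots,n$, and a non-decreasing positive penalty sequence $\{\beta_k\}$. For $K\ge 0$ define $\bar x^K=\sum_{k=0}^K\gamma_k x^{k+1}$, where $\gamma_k=\beta_k^{-1}\big/\sum_{j=0}^K\beta_j^{-1}$. Then $$f(\bar x^K)-f(x^* )+\sum_{i=1}^n\big\langle\mathcal{A}_i^\dagger(\lambda^* ),\bar x_i^K-x_i^*\big\rangle+\frac{\alpha\beta_0}{2}\Big\|\sum_{i=1}^n\mathcal{A}_i(\bar x_i^K)-b\Big\|^2\le \frac{C_0}{2\sum_{k=0}^K\beta_k^{-1}},$$ where $$\alpha^{-1}=(n+1)\max\Big(1,\Big\{\frac{\|\mathcal{A}_i\|^2}{\eta_i-n\|\mathcal{A}_i\|^2},\ i=1,\dots,n\Big\}\Big),\qquad C_0=\sum_{i=1}^n\eta_i\|x_i^0-x_i^*\|^2+\beta_0^{-2}\|\lambda^0-\lambda^*\|^2 .$$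
   Context: Problem data: $f_i:\mathbb{R}^{d_i}\to\mathbb{R}\cup\{+\infty\}$ are closed proper convex functions, $\mathcal{A}_i:\mathbb{R}^{d_i}\to\mathbb{R}^m$ are linear mappings with adjoints $\mathcal{A}_i^\dagger$ and operator norms $\|\mathcal{A}_i\|$, and $b\in\mathbb{R}^m$; $\|\cdot\|$ on vectors (or matrices) is the Euclidean (Frobenius) norm. Standing assumptions: no $\mathcal{A}_i$ is the zero mapping; the solution of $\sum_i\mathcal{A}_i(x_i)=b$ is non-unique; the mapping $(x_1,\dots,x_n)\mapsto\sum_i\mathcal{A}_i(x_i)$ is onto $\mathbb{R}^m$. KKT point: $(x_1^*,\dots,x_n^*,\lambda^* )$ with $\sum_i\mathcal{A}_i(x_i^* )=b$ and $-\mathcal{A}_i^\dagger(\lambda^* )\in\partial f_i(x_i^* )$ for all $i$, where $\partial f_i$ is the convex subdifferential. LADMPSAP, with parameters $\eta_i$ and penalty parameters $\beta_k>0$, run without stopping from an arbitrary $(x_1^0,\dots,x_n^0,\lambda^0)$: given $(x_1^k,\dots,x_n^k,\lambda^k)$, set $$\hat\lambda^k=\lambda^k+\beta_k\Big(\sum_{i=1}^n\mathcal{A}_i(x_i^k)-b\Big),$$ $$x_i^{k+1}=\operatorname*{argmin}_{x_i}\ f_i(x_i)+\frac{\eta_i\beta_k}{2}\Big\|x_i-x_i^k+\frac{\mathcal{A}_i^\dagger(\hat\lambda^k)}{\eta_i\beta_k}\Big\|^2,\quad i=1,\dots,n,$$ $$\lambda^{k+1}=\lambda^k+\beta_k\Big(\sum_{i=1}^n\mathcal{A}_i(x_i^{k+1})-b\Big).$$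 The penalty sequence may be bounded or unbounded. *)

(* Defs.v *)
From HB Require Import structures.
From mathcomp Require Import all_boot all_order all_algebra.
From mathcomp Require Import all_classical all_reals all_analysis.

Set Implicit Arguments.
Unset Strict Implicit.
Unset Printing Implicit Defensive.

Import Order.TTheory GRing.Theory Num.Theory.
Import numFieldNormedType.Exports.

Local Open Scope classical_set_scope.
Local Open Scope ring_scope.

(* The norm that the library puts on matrices is the sup norm, so the Euclidean
   structure of R^d is given by the definitions below.  The library topology on
   'rV[R]_d is the Euclidean one. *)
Definition dotv (R : realType) (d : nat) (u v : 'rV[R]_d) : R :=
  \sum_j u 0 j * v 0 j.

Definition enorm (R : realType) (d : nat) (u : 'rV[R]_d) : R :=
  Num.sqrt (dotv u u).

Definition adjoint (R : realType) (d m : nat)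
    (A : {linear 'rV[R]_d -> 'rV[R]_m}) (y : 'rV[R]_m) : 'rV[R]_d :=
  y *m (lin1_mx A)^T.

Lemma adjointP (R : realType) (d m : nat)
    (A : {linear 'rV[R]_d -> 'rV[R]_m}) (x : 'rV[R]_d) (y : 'rV[R]_m) :
  dotv (A x) y = dotv x (adjoint A y).
Proof.
have dotvE k (u v : 'rV[R]_k) : dotv u v = (u *m v^T) 0 0.
  by rewrite /dotv mxE; apply: eq_bigr => j _; rewrite mxE.
by rewrite !dotvE /adjoint trmx_mul trmxK mulmxA mul_rV_lin1.
Qed.

Definition opnorm (R : realType) (d m : nat)
    (A : {linear 'rV[R]_d -> 'rV[R]_m}) : R :=
  sup [set enorm (A u) | u in [set u : 'rV[R]_d | enorm u <= 1]].

Lemma opnorm_has_sup (R : realType) (d m : nat)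
    (A : {linear 'rV[R]_d -> 'rV[R]_m}) :
  has_sup [set enorm (A u) | u in [set u : 'rV[R]_d | enorm u <= 1]].
Proof.
split.
  exists (enorm (A 0)), 0 => //=; rewrite /enorm /dotv big1 ?sqrtr0 // => j _.
  by rewrite mxE mul0r.
exists (Num.sqrt (\sum_j (\sum_i `|lin1_mx A i j|) ^+ 2)) => _ [u /= u1 <-].
have uj k : `|u 0 k| <= 1.
  apply: le_trans u1; rewrite /enorm -sqrtr_sqr ler_wsqrtr // expr2 /dotv.
  by rewrite (bigD1 k) //= lerDl sumr_ge0 // => j _; rewrite -expr2 sqr_ge0.
rewrite /enorm ler_wsqrtr // /dotv ler_sum // => j _.
rewrite -expr2 -(real_normK (num_real (A u 0 j))) lerXn2r ?nnegrE ?sumr_ge0 //.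
rewrite -mul_rV_lin1 mxE (le_trans (ler_norm_sum _ _ _)) // ler_sum // => i _.
by rewrite normrM ler_piMl.
Qed.

Definition epigraph (R : realType) (d : nat) (f : 'rV[R]_d -> \bar R) :
    set ('rV[R]_d * R) :=
  [set p | (f p.1 <= p.2%:E)%E].

Definition closed_fun (R : realType) (d : nat) (f : 'rV[R]_d -> \bar R) : Prop :=
  closed (epigraph f).

Definition proper_fun (R : realType) (d : nat) (f : 'rV[R]_d -> \bar R) : Prop :=
  (forall u, f u <> -oo%E) /\ (exists u, f u <> +oo%E).

(* For proper f the right-hand side is never of the form oo - oo. *)
Definition convex_fun (R : realType) (d : nat) (f : 'rV[R]_d -> \bar R) : Prop :=
  forall (u v : 'rV[R]_d) (t : R), 0 < t -> t < 1 ->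
    (f (t *: u + (1 - t) *: v)%R <= t%:E * f u + (1 - t)%:E * f v)%E.

(* For proper f, the set is empty at every u with f u = +oo. *)
Definition subdifferential (R : realType) (d : nat) (f : 'rV[R]_d -> \bar R)
    (u : 'rV[R]_d) : set 'rV[R]_d :=
  [set g | forall v, (f u + (dotv g (v - u))%:E <= f v)%E].

Definition argmin (R : realType) (T : Type) (h : T -> \bar R) : set T :=
  [set u | forall v, (h u <= h v)%E].

Section Problem.
Context (R : realType) (n m : nat) (d : 'I_n -> nat).

(* The product of the spaces R^(d i), i < n. *)
Definition blocks : Type := forall i : 'I_n, 'rV[R]_(d i).

Implicit Types (f : forall i : 'I_n, 'rV[R]_(d i) -> \bar R)
  (A : forall i : 'I_n, {linear 'rV[R]_(d i) -> 'rV[R]_m})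
  (b : 'rV[R]_m) (eta : 'I_n -> R) (beta : nat -> R)
  (x : nat -> blocks) (lam : nat -> 'rV[R]_m).

Definition objective f (z : blocks) : \bar R := (\sum_(i < n) f i (z i))%E.

Definition sumA A (z : blocks) : 'rV[R]_m := \sum_(i < n) A i (z i).

Definition KKT_point f A b (xs : blocks) (ls : 'rV[R]_m) : Prop :=
  sumA A xs = b /\
  forall i, subdifferential (f i) (xs i) (- adjoint (A i) ls).

Definition lambda_hat A b beta x lam (k : nat) : 'rV[R]_m :=
  lam k + beta k *: (sumA A (x k) - b).

(* The starting point (x 0, lam 0) is unconstrained. *)
Definition LADMPSAP f A b eta beta x lam : Prop :=
  forall k : nat,
    (forall i, argmin
       (fun u : 'rV[R]_(d i) =>
          f i u + (eta i * beta k / 2 *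
            enorm (u - x k i + (eta i * beta k)^-1 *:
                     adjoint (A i) (lambda_hat A b beta x lam k)) ^+ 2)%:E)%E
       (x k.+1 i)) /\
    lam k.+1 = lam k + beta k *: (sumA A (x k.+1) - b).

Definition gamma beta (K k : nat) : R :=
  (beta k)^-1 / \sum_(0 <= j < K.+1) (beta j)^-1.

Definition ergodic beta x (K : nat) : blocks :=
  fun i => \sum_(0 <= k < K.+1) gamma beta K k *: x k.+1 i.

Definition alpha A eta : R :=
  (n.+1%:R * \big[Num.max/1]_(i < n)
     (opnorm (A i) ^+ 2 / (eta i - n%:R * opnorm (A i) ^+ 2)))^-1.

Definition C0 eta beta x lam (xs : blocks) (ls : 'rV[R]_m) : R :=
  \sum_(i < n) eta i * enorm (x 0%N i - xs i) ^+ 2 +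
  (beta 0%N)^-2 * enorm (lam 0%N - ls) ^+ 2.

End Problem.

(* Main.v *)
Require Import Defs.
From mathcomp Require Import all_boot all_order all_algebra.
From mathcomp Require Import all_classical all_reals all_analysis.
From mathcomp Require Import ring lra.
Set Implicit Arguments.
Unset Strict Implicit.
Unset Printing Implicit Defensive.
Import Order.TTheory GRing.Theory Num.Theory.
Import numFieldNormedType.Exports.
Local Open Scope classical_set_scope.
Local Open Scope ring_scope.

(** Write r_k for the residual sum_i A_i x_i^k - b, and measure the distance of
the k-th iterate to the KKT point by

  V_k = sum_i eta_i |x_i^k - x*_i|^2 + beta_k^-2 |lam^k - ls|^2,

so that C0 = V_0.  The theorem is the statement that V decreases at each step
by at least twice the objective gap weighted by beta_k^-1, plus a multiple of
the squared residual; everything else is averaging.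

One step.  The proximal update makes - (eta_i beta_k (x_i^{k+1} - x_i^k) + A_i^*
lamhat^k) a subgradient of f_i at x_i^{k+1} ([prox_subgradient]).  Testing it at
x*_i, adding the linear term in ls and summing over i bounds the gap by inner
products that the three-point identity turns into differences of squared
distances.  The predicted multiplier lamhat^k differs from lam^{k+1} by
beta_k sum_i A_i (x_i^k - x_i^{k+1}), so what remains is the quadratic form

  sum_i eta_i |w_i|^2 + |r|^2 - 2 <sum_i A_i w_i, r>

at w = x^{k+1} - x^k and r = r_{k+1}.  The condition eta_i > n |A_i|^2 is what
makes it positive; [residual_coercive] shows that it dominates alpha |r|^2.
The outcome is [ladmpsap_step].

Summation.  The step compares both multiplier terms with the same weight
beta_k^-2; since beta is non-decreasing, replacing it by beta_{k+1}^-2 on the new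
term only helps, and the bounds telescope ([weighted_telescope]) to

  sum_k (beta_k^-1 gap_k + alpha / 2 |r_{k+1}|^2) <= C0 / 2.

Averaging.  Dividing by S = sum_k beta_k^-1 turns the gaps into their
gamma-average, which bounds the gap at the ergodic point by Jensen's inequality
for each f_i ([convex_jensen]).  The same inequality for the squared norm, with
beta_k^-1 <= beta_0^-1, gives beta_0 |sum_i A_i xbar_i - b|^2 <= S^-1 sum_k
|r_{k+1}|^2, the last ingredient. *)

(** * The Euclidean inner product and the operator norm *)

Lemma dotvC (R : realType) (d : nat) (u v : 'rV[R]_d) : dotv u v = dotv v u.
Proof. by apply: eq_bigr => j _; rewrite mulrC. Qed.

Lemma dotvDl (R : realType) (d : nat) (u v w : 'rV[R]_d) :
  dotv (u + v) w = dotv u w + dotv v w.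
Proof. by rewrite -big_split; apply: eq_bigr => j _; rewrite mxE mulrDl. Qed.

Lemma dotvZl (R : realType) (d : nat) (a : R) (u w : 'rV[R]_d) :
  dotv (a *: u) w = a * dotv u w.
Proof. by rewrite mulr_sumr; apply: eq_bigr => j _; rewrite mxE mulrA. Qed.

Lemma dotvNl (R : realType) (d : nat) (u w : 'rV[R]_d) :
  dotv (- u) w = - dotv u w.
Proof. by rewrite -scaleN1r dotvZl mulN1r. Qed.

Lemma dotvBl (R : realType) (d : nat) (u v w : 'rV[R]_d) :
  dotv (u - v) w = dotv u w - dotv v w.
Proof. by rewrite dotvDl dotvNl. Qed.

Lemma dotvDr (R : realType) (d : nat) (u v w : 'rV[R]_d) :
  dotv w (u + v) = dotv w u + dotv w v.
Proof. by rewrite !(dotvC w) dotvDl. Qed.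

Lemma dotvZr (R : realType) (d : nat) (a : R) (u w : 'rV[R]_d) :
  dotv w (a *: u) = a * dotv w u.
Proof. by rewrite !(dotvC w) dotvZl. Qed.

Lemma dotvNr (R : realType) (d : nat) (u w : 'rV[R]_d) :
  dotv w (- u) = - dotv w u.
Proof. by rewrite !(dotvC w) dotvNl. Qed.

Lemma dotvBr (R : realType) (d : nat) (u v w : 'rV[R]_d) :
  dotv w (u - v) = dotv w u - dotv w v.
Proof. by rewrite !(dotvC w) dotvBl. Qed.

Lemma dotv_suml (R : realType) (d : nat) (I : Type) (r : seq I)
    (F : I -> 'rV[R]_d) (w : 'rV[R]_d) :
  dotv (\sum_(i <- r) F i) w = \sum_(i <- r) dotv (F i) w.
Proof.
apply: (big_morph (fun u => dotv u w)) => [u v|]; first exact: dotvDl.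
by rewrite -(scale0r w) dotvZl mul0r.
Qed.

Lemma dotv_ge0 (R : realType) (d : nat) (u : 'rV[R]_d) : 0 <= dotv u u.
Proof. by apply: sumr_ge0 => j _; rewrite -expr2 sqr_ge0. Qed.

Lemma enorm_sqr (R : realType) (d : nat) (u : 'rV[R]_d) :
  enorm u ^+ 2 = dotv u u.
Proof. by rewrite sqr_sqrtr ?dotv_ge0. Qed.

Lemma dotv_three_point (R : realType) (d : nat) (u v w : 'rV[R]_d) :
  2 * dotv (u - v) (u - w) =
  dotv (u - v) (u - v) + dotv (u - w) (u - w) - dotv (v - w) (v - w).
Proof.
rewrite !dotvBl !dotvBr (dotvC v u) (dotvC w u) (dotvC w v); ring.
Qed.

Lemma dotv_sqrDZ (R : realType) (d : nat) (t : R) (u w : 'rV[R]_d) :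
  dotv (u + t *: w) (u + t *: w) =
  dotv u u + 2 * t * dotv u w + t ^+ 2 * dotv w w.
Proof. by rewrite !dotvDl !dotvDr !dotvZl !dotvZr (dotvC w u); ring. Qed.

Lemma enormZ (R : realType) (d : nat) (a : R) (u : 'rV[R]_d) :
  enorm (a *: u) = `|a| * enorm u.
Proof.
by rewrite /enorm dotvZl dotvZr mulrA -expr2 sqrtrM ?sqr_ge0 // sqrtr_sqr.
Qed.

Lemma enorm0_eq0 (R : realType) (d : nat) (u : 'rV[R]_d) :
  enorm u = 0 -> u = 0.
Proof.
move=> u0; have : dotv u u = 0 by rewrite -enorm_sqr u0 expr0n.
move/eqP; rewrite psumr_eq0 => [/allP uj|j _]; last by rewrite -expr2 sqr_ge0.
apply/rowP => j; rewrite mxE; apply/eqP; rewrite -sqrf_eq0 expr2.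
exact: uj (mem_index_enum j).
Qed.

(** At u = 0 both sides vanish; otherwise u / |u| is one of the vectors over which
the supremum is taken. *)
Lemma opnormP (R : realType) (d m : nat)
    (A : {linear 'rV[R]_d -> 'rV[R]_m}) (u : 'rV[R]_d) :
  enorm (A u) <= opnorm A * enorm u.
Proof.
have [u0|u0] := eqVneq (enorm u) 0.
  rewrite (enorm0_eq0 u0) linear0 /enorm -(scale0r (0 : 'rV[R]_m)).
  by rewrite -(scale0r (0 : 'rV[R]_d)) !dotvZl !mul0r sqrtr0 mulr0.
have ugt0 : 0 < enorm u by rewrite lt0r u0 sqrtr_ge0.
rewrite -ler_pdivrMr // mulrC -[(enorm u)^-1]gtr0_norm ?invr_gt0 // -enormZ.
rewrite -linearZ; apply: ub_le_sup; first by case: (opnorm_has_sup A).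
exists ((enorm u)^-1 *: u) => //=.
by rewrite enormZ gtr0_norm ?invr_gt0 // mulVf.
Qed.

(** * Convex extended-real-valued functions *)

(** The optimality condition of a proximal step.  The quadratic is differentiable
while f need not be, so the condition is read off the segment from u to v:
convexity bounds f along it by its chord, the quadratic is expanded exactly, and
the second-order term disappears as the point tends to u. *)
Lemma prox_subgradient (R : realType) (d : nat) (f : 'rV[R]_d -> \bar R)
    (f_proper : proper_fun f) (f_convex : convex_fun f)
    (c : R) (c_gt0 : 0 < c) (x g u : 'rV[R]_d) :
  argmin (fun v => f v + (c / 2 * enorm (v - x + c^-1 *: g) ^+ 2)%:E)%E u ->
  subdifferential f u (- (c *: (u - x) + g)).
Proof.
case: f_proper => fNy [v0 fv0] umin.
have fu_fin : f u \is a fin_num.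
  have := umin v0; move: (fNy u) (fNy v0) fv0.
  by case: (f u) (f v0) => [a||] [a'||].
move=> v; have [->|fvy] := eqVneq (f v) +oo%E; first by rewrite leey.
have fv_fin : f v \is a fin_num by rewrite fin_numE fvy andbT; apply/eqP.
move: (fine (f u)) (esym (fineK fu_fin)) => fu fuE.
move: (fine (f v)) (esym (fineK fv_fin)) => fv fvE.
rewrite fuE fvE -EFinD lee_fin.
have [p pE] : exists p, p = u - x + c^-1 *: g by exists (u - x + c^-1 *: g).
have [w wE] : exists w, w = v - u by exists (v - u).
have -> : c *: (u - x) + g = c *: p.
  by rewrite pE [RHS]scalerDr scalerA divff ?scale1r // gt_eqF.
rewrite -wE dotvNl dotvZl.
(* Comparing u with u + t (v - u) and dividing by t leaves an error O(t). *)
have approx t : 0 < t -> t < 1 ->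
    fu <= fv + c * dotv p w + t * (c / 2 * dotv w w).
  move=> t0 t1; have := umin (t *: v + (1 - t) *: u).
  have -> : t *: v + (1 - t) *: u - x + c^-1 *: g = p + t *: w.
    by rewrite pE wE; apply/rowP => j; rewrite !mxE; ring.
  rewrite -pE !enorm_sqr => opt.
  have := f_convex v u t t0 t1; rewrite fuE fvE -!EFinM -EFinD => conv.
  have := le_trans opt (leeD2r _ conv).
  rewrite fuE -!EFinD lee_fin dotv_sqrDZ -(ler_pM2l t0 fu).
  move: (dotv p p) (dotv p w) (dotv w w) => pp pw ww; lra.
suff : fu <= fv + c * dotv p w by lra.
(* With q the coefficient of t, this t lies in ]0, 1[ and satisfies t q <= e,
   also when q = 0. *)
apply/ler_addgt0Pr => e e0.
set q := c / 2 * dotv w w in approx.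
have q0 : 0 <= q by rewrite mulr_ge0 ?dotv_ge0 // divr_ge0 ?ltW.
have D0 : 0 < q + e + 1 by lra.
have t0 : 0 < e / (q + e + 1) by rewrite divr_gt0.
have t1 : e / (q + e + 1) < 1 by rewrite ltr_pdivrMr // mul1r; lra.
apply: le_trans (approx _ t0 t1) _; rewrite lerD2l.
rewrite mulrAC ler_pdivrMr //; nra.
Qed.

(** Jensen's inequality for unnormalized weights.  Bounding the values by reals v k,
that is, working in the epigraph, keeps the induction free of infinite values.
Adding a point is convexity on the segment from the previous average to it. *)
Lemma convex_jensen (R : realType) (d : nat) (f : 'rV[R]_d -> \bar R)
    (f_convex : convex_fun f) (w : nat -> R) (w_gt0 : forall k, 0 < w k)
    (y : nat -> 'rV[R]_d) (v : nat -> R) (fyv : forall k, (f (y k) <= (v k)%:E)%E)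
    (K : nat) (W := \sum_(0 <= k < K.+1) w k) :
  (f (\sum_(0 <= k < K.+1) (w k / W) *: y k)%R
   <= (\sum_(0 <= k < K.+1) w k / W * v k)%R%:E)%E.
Proof.
rewrite {}/W; elim: K => [|K IH].
  by rewrite !big_nat1 divff ?gt_eqF // scale1r mul1r.
have Wgt0 N : 0 < \sum_(0 <= k < N.+1) w k.
  rewrite big_nat_recr //= ltr_wpDl // sumr_ge0 // => k _; exact: ltW.
set W := \sum_(0 <= k < K.+1) w k in IH *.
have W0 : 0 < W := Wgt0 K.
set W' := \sum_(0 <= k < K.+2) w k.
have W'0 : 0 < W' := Wgt0 K.+1.
have W'E : W' = W + w K.+1 by rewrite /W' big_nat_recr.
set t := W / W'.
have t0 : 0 < t by rewrite divr_gt0.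
have t1 : t < 1 by rewrite ltr_pdivrMr // mul1r W'E ltrDl.
have t1E : w K.+1 / W' = 1 - t.
  by rewrite /t W'E; field; rewrite -W'E gt_eqF.
have tE k : w k / W' = t * (w k / W).
  by rewrite /t; field; rewrite !gt_eqF.
have -> : \sum_(0 <= k < K.+2) (w k / W') *: y k =
    t *: (\sum_(0 <= k < K.+1) (w k / W) *: y k) + (1 - t) *: y K.+1.
  rewrite big_nat_recr //= t1E scaler_sumr; congr (_ + _).
  by apply: eq_bigr => k _; rewrite tE scalerA.
have -> : \sum_(0 <= k < K.+2) w k / W' * v k =
    t * (\sum_(0 <= k < K.+1) w k / W * v k) + (1 - t) * v K.+1.
  rewrite big_nat_recr //= t1E mulr_sumr; congr (_ + _).
  by apply: eq_bigr => k _; rewrite tE -[LHS]mulrA.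
apply: le_trans (f_convex _ _ _ t0 t1) _.
have t'0 : 0 < 1 - t by rewrite subr_gt0.
rewrite [leRHS]EFinD !EFinM.
by apply: leeD; apply: lee_wpmul2l => //; rewrite lee_fin ltW.
Qed.

(** The gap in the convexity inequality is t (1 - t) |u - v|^2. *)
Lemma convex_sqr_enorm (R : realType) (d : nat) :
  convex_fun (fun u : 'rV[R]_d => (enorm u ^+ 2)%:E).
Proof.
move=> u v t t0 t1; rewrite -!EFinM -EFinD lee_fin !enorm_sqr.
have := dotv_ge0 (u - v).
rewrite !(dotvDl, dotvDr, dotvZl, dotvZr, dotvNl, dotvNr) (dotvC v u) => uv.
have t' : 0 <= t * (1 - t) by rewrite mulr_ge0 ?subr_ge0 // ltW.
have := mulr_ge0 t' uv; lra.
Qed.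

Lemma subdifferential_fin_num (R : realType) (d : nat) (f : 'rV[R]_d -> \bar R)
    (f_proper : proper_fun f) (u g : 'rV[R]_d) :
  subdifferential f u g -> f u \is a fin_num.
Proof.
case: f_proper => fNy [v fv] /(_ v); move: (fNy u) (fNy v) fv.
by case: (f u) (f v) => [a||] [a'||].
Qed.

(** * One step of the algorithm *)

Lemma sumAB (R : realType) (n m : nat) (d : 'I_n -> nat)
    (A : forall i : 'I_n, {linear 'rV[R]_(d i) -> 'rV[R]_m}) (z w : blocks R d) :
  sumA A (fun i => z i - w i) = sumA A z - sumA A w.
Proof.
by rewrite /sumA -sumrB; apply: eq_bigr => i _; rewrite linearB.
Qed.

(** With M the maximum in alpha, the constant s = M / (n M + 1) satisfies
|A_i|^2 <= s eta_i for every i: this is M >= |A_i|^2 / (eta_i - n |A_i|^2) solved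
for the ratio |A_i|^2 / eta_i.  Young's inequality with weight s then gives
eta_i |w_i|^2 - 2 <A_i w_i, r> >= - s |r|^2.  Summing over i leaves
1 - n s = 1 / (n M + 1) in front of |r|^2, which is at least
1 / ((n + 1) M) = alpha because M >= 1. *)
Lemma residual_coercive (R : realType) (n m : nat) (d : 'I_n -> nat)
    (A : forall i : 'I_n, {linear 'rV[R]_(d i) -> 'rV[R]_m})
    (eta : 'I_n -> R) (eta_gt : forall i, n%:R * opnorm (A i) ^+ 2 < eta i)
    (w : blocks R d) (r : 'rV[R]_m) :
  alpha A eta * dotv r r <=
  \sum_i eta i * dotv (w i) (w i) + dotv r r - 2 * dotv (sumA A w) r.
Proof.
rewrite /alpha; set M := \big[_/_]_(i < n) _.
have M1 : 1 <= M by exact: bigmax_ge_id.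
have M0 : 0 < M by lra.
have n0 : 0 <= n%:R :> R by [].
have nM0 : 0 < n%:R * M + 1 by rewrite ltr_wpDl // mulr_ge0 // ltW.
set s := M / (n%:R * M + 1).
have s0 : 0 < s by rewrite divr_gt0.
have opnorm_s i : opnorm (A i) ^+ 2 <= s * eta i.
  rewrite /s mulrAC ler_pdivlMr //.
  have : opnorm (A i) ^+ 2 / (eta i - n%:R * opnorm (A i) ^+ 2) <= M.
    exact: le_bigmax.
  by rewrite ler_pdivrMr ?subr_gt0 //; lra.
have block i : 0 <= eta i * dotv (w i) (w i) - 2 * dotv (A i (w i)) r + s * dotv r r.
  have Aw : dotv (A i (w i)) (A i (w i)) <= s * eta i * dotv (w i) (w i).
    apply: le_trans (_ : opnorm (A i) ^+ 2 * dotv (w i) (w i) <= _).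
      rewrite -!enorm_sqr -exprMn lerXn2r ?nnegrE ?sqrtr_ge0 ?opnormP //.
      exact: le_trans (sqrtr_ge0 _) (opnormP _ _).
    by rewrite ler_wpM2r ?dotv_ge0.
  (* s times the left-hand side is at least |A_i w_i - s r|^2. *)
  rewrite -(pmulr_rge0 _ s0).
  have := dotv_ge0 (A i (w i) + (- s) *: r); rewrite dotv_sqrDZ.
  by move: Aw; move: (dotv (A i _) _) (dotv _ r) (dotv r r) => yy yr rr; lra.
have : 0 <= \sum_i (eta i * dotv (w i) (w i) - 2 * dotv (A i (w i)) r + s * dotv r r).
  by apply: sumr_ge0 => i _; exact: block.
rewrite big_split sumrB -mulr_sumr -dotv_suml sumr_const card_ord -/(sumA A w).
rewrite -[_ *+ n]mulr_natr /=.
suff : (n.+1%:R * M)^-1 * dotv r r <= dotv r r - s * dotv r r * n%:R.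
  move: (\sum_i _) (dotv _ r) (_^-1 * _) (s * _ * _) => t1 t2 t3 t4; lra.
have -> : dotv r r - s * dotv r r * n%:R = (n%:R * M + 1)^-1 * dotv r r.
  by rewrite /s; field; rewrite gt_eqF.
rewrite ler_wpM2r ?dotv_ge0 // lef_pV2 ?posrE ?mulr_gt0 //.
by rewrite -natr1 mulrDl mul1r lerD2l.
Qed.

(** Here (z, l) is updated to (z', l') with penalty bt, F and Fs are the values of
the f_i at z' and xs, and [hF] is the subgradient inequality of the proximal step
tested at xs.  Write h for the predicted multiplier and r for the new residual.
The linear terms in ls and h combine to - <r, h - ls>, and
h - ls = (l' - ls) - bt sum_i A_i w_i: as r is (l' - l) / bt, the first part is a
difference of squared multiplier distances, and the second is the cross term that
[residual_coercive] absorbs. *)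
Lemma ladmpsap_step (R : realType) (n m : nat) (d : 'I_n -> nat)
    (A : forall i : 'I_n, {linear 'rV[R]_(d i) -> 'rV[R]_m}) (b : 'rV[R]_m)
    (eta : 'I_n -> R) (eta_gt : forall i, n%:R * opnorm (A i) ^+ 2 < eta i)
    (z z' xs : blocks R d) (l l' ls : 'rV[R]_m) (bt : R) (bt_gt0 : 0 < bt)
    (F Fs : 'I_n -> R) (xs_feasible : sumA A xs = b)
    (hF : forall i, F i + dotv (- ((eta i * bt) *: (z' i - z i) +
       adjoint (A i) (l + bt *: (sumA A z - b)))) (xs i - z' i) <= Fs i)
    (hl : l' = l + bt *: (sumA A z' - b)) :
  bt^-1 * (\sum_i (F i - Fs i) + \sum_i dotv (adjoint (A i) ls) (z' i - xs i))
  + alpha A eta / 2 * enorm (sumA A z' - b) ^+ 2 <=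
  (\sum_i eta i * enorm (z i - xs i) ^+ 2 + bt^-2 * enorm (l - ls) ^+ 2
   - (\sum_i eta i * enorm (z' i - xs i) ^+ 2 + bt^-2 * enorm (l' - ls) ^+ 2)) / 2.
Proof.
have primalE (y : blocks R d) : \sum_i eta i * enorm (y i - xs i) ^+ 2 =
    \sum_i eta i * dotv (y i - xs i) (y i - xs i).
  by apply: eq_bigr => i _; rewrite enorm_sqr.
rewrite !primalE !enorm_sqr.
set h := l + bt *: (sumA A z - b) in hF.
have [r rE] : exists r, r = sumA A z' - b by exists (sumA A z' - b).
have [w wE] : exists w : blocks R d, w = fun i => z' i - z i.
  by exists (fun i => z' i - z i).
rewrite -rE in hl *.
have rsum : \sum_i A i (z' i - xs i) = r by rewrite rE -xs_feasible -sumAB.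
have hE : h - ls = (l' - ls) - bt *: sumA A w.
  rewrite hl wE sumAB rE /h; apply/rowP => j; rewrite !mxE; ring.
(* The subgradient inequality of block i after the three-point identity. *)
have block i : bt^-1 * (F i - Fs i + dotv (adjoint (A i) ls) (z' i - xs i)) <=
    eta i / 2 * (dotv (z i - xs i) (z i - xs i) - dotv (z' i - xs i) (z' i - xs i)
                 - dotv (w i) (w i)) - bt^-1 * dotv (A i (z' i - xs i)) (h - ls).
  have : F i + (eta i * bt * dotv (z' i - z i) (z' i - xs i)
                + dotv (A i (z' i - xs i)) h) <= Fs i.
    have := hF i; rewrite -(opprB (z' i) (xs i)) dotvNr dotvNl opprK.
    by rewrite (dotvDl (_ *: _)) dotvZl (dotvC (adjoint _ h)) -adjointP.
  rewrite (dotvC (adjoint _ ls)) -adjointP (dotvBr h) wE.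
  have := dotv_three_point (z' i) (z i) (xs i).
  move: (dotv (z' i - z i) (z' i - xs i)) (dotv (A i _) h) (dotv (A i _) ls).
  move: (dotv (z i - _) _) (dotv (z' i - xs i) _) (dotv (z' i - z i) _).
  move=> p1 p2 p3 p4 p5 p6 tp sub.
  rewrite -subr_ge0.
  have -> : eta i / 2 * (p1 - p2 - p3) - bt^-1 * (p5 - p6) - bt^-1 * (F i - Fs i + p6)
     = bt^-1 * (Fs i - (F i + (eta i * bt * p4 + p5))).
    have -> : p1 = p3 + p2 - 2 * p4 by lra.
    by field; rewrite gt_eqF.
  by rewrite mulr_ge0 ?subr_ge0 // invr_ge0 ltW.
have sum_block : bt^-1 * (\sum_i (F i - Fs i) +
      \sum_i dotv (adjoint (A i) ls) (z' i - xs i)) <=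
    (\sum_i eta i * dotv (z i - xs i) (z i - xs i)
     - \sum_i eta i * dotv (z' i - xs i) (z' i - xs i)
     - \sum_i eta i * dotv (w i) (w i)) / 2 - bt^-1 * dotv r (h - ls).
  rewrite -big_split mulr_sumr -!sumrB mulr_suml -rsum dotv_suml mulr_sumr -sumrB.
  apply: ler_sum => i _; apply: le_trans (block i) _.
  rewrite le_eqVlt; apply/orP; left; apply/eqP; ring.
have coercive := residual_coercive eta_gt w r.
have lE : dotv (l - ls) (l - ls) =
    dotv (l' - ls) (l' - ls) - 2 * bt * dotv r (l' - ls) + bt ^+ 2 * dotv r r.
  have -> : l - ls = l' - ls + (- bt) *: r.
    by rewrite hl; apply/rowP => j; rewrite !mxE; ring.
  by rewrite dotv_sqrDZ (dotvC _ r); ring.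
have dualE : bt^-2 * dotv (l - ls) (l - ls) - bt^-2 * dotv (l' - ls) (l' - ls) =
    dotv r r - 2 * (bt^-1 * dotv r (l' - ls)).
  by rewrite lE; field; rewrite gt_eqF.
have rh : bt^-1 * dotv r (h - ls) = bt^-1 * dotv r (l' - ls) - dotv (sumA A w) r.
  by rewrite hE (dotvBr (l' - ls)) dotvZr (dotvC _ r); field; rewrite gt_eqF.
rewrite rh in sum_block.
move: sum_block coercive dualE.
set X := \sum_i (F i - Fs i) + _.
move: (bt^-1 * X) (bt^-1 * dotv r _) (dotv (sumA A w) r) (dotv r r) (bt^-2 * _).
move=> a1 a2 a3 a4 a5; move: (bt^-2 * _) => a6; lra.
Qed.

(** * Summation over the steps *)

(** As beta is non-decreasing, (beta k)^-2 may be lowered to (beta k.+1)^-2 in front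
of D k.+1, and then the right-hand sides telescope. *)
Lemma weighted_telescope (R : realType) (beta : nat -> R)
    (beta_gt0 : forall k, 0 < beta k) (beta_nd : nondecreasing_seq beta)
    (a P D : nat -> R) (P_ge0 : forall k, 0 <= P k) (D_ge0 : forall k, 0 <= D k)
    (step : forall k, a k <= (P k + (beta k)^-2 * D k
                              - (P k.+1 + (beta k)^-2 * D k.+1)) / 2) (N : nat) :
  \sum_(0 <= k < N) a k <= (P 0%N + (beta 0%N)^-2 * D 0%N) / 2.
Proof.
set V := fun k => P k + (beta k)^-2 * D k.
have V_step k : a k <= (V k - V k.+1) / 2.
  apply: le_trans (step k) _; rewrite ler_pM2r ?invr_gt0 // lerD2l lerN2 lerD2l.
  rewrite ler_wpM2r // lef_pV2 ?posrE ?exprn_gt0 //.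
  by rewrite lerXn2r ?nnegrE ?(ltW (beta_gt0 _)) ?beta_nd.
have V_ge0 k : 0 <= V k by rewrite addr_ge0 // mulr_ge0 // invr_ge0 exprn_ge0 // ltW.
apply: le_trans (_ : (V 0%N - V N) / 2 <= _); last first.
  by rewrite ler_pM2r ?invr_gt0 // lerBlDr lerDl.
elim: N => [|N IH]; first by rewrite big_nil subrr mul0r.
by rewrite big_nat_recr //=; move: IH (V_step N); lra.
Qed.

(** * Ergodic averages *)

Lemma gamma_sum (R : realType) (beta : nat -> R)
    (beta_gt0 : forall k, 0 < beta k) (K : nat) :
  \sum_(0 <= k < K.+1) gamma beta K k = 1.
Proof.
rewrite /gamma -mulr_suml divff // gt_eqF // big_nat_recr //= ltr_wpDl ?invr_gt0 //.
by rewrite sumr_ge0 // => k _; rewrite invr_ge0 ltW.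
Qed.

(** An average with total weight 1 commutes with translations. *)
Lemma weighted_sumB (R : realType) (V : lmodType R) (r : seq nat) (w : nat -> R)
    (w1 : \sum_(k <- r) w k = 1) (y : nat -> V) (c : V) :
  \sum_(k <- r) w k *: (y k - c) = \sum_(k <- r) w k *: y k - c.
Proof.
under eq_bigr do rewrite scalerBr.
by rewrite sumrB -scaler_suml w1 scale1r.
Qed.

Lemma sumA_ergodic (R : realType) (n m : nat) (d : 'I_n -> nat)
    (A : forall i : 'I_n, {linear 'rV[R]_(d i) -> 'rV[R]_m})
    (beta : nat -> R) (x : nat -> blocks R d) (K : nat) :
  sumA A (ergodic beta x K) =
  \sum_(0 <= k < K.+1) gamma beta K k *: sumA A (x k.+1).
Proof.
under [RHS]eq_bigr do rewrite scaler_sumr.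
rewrite exchange_big; apply: eq_bigr => i _.
by rewrite linear_sum; apply: eq_bigr => k _; rewrite linearZ.
Qed.

Theorem theorem4 (R : realType) (n m : nat) (d : 'I_n -> nat)
  (f : forall i : 'I_n, 'rV[R]_(d i) -> \bar R)
  (A : forall i : 'I_n, {linear 'rV[R]_(d i) -> 'rV[R]_m})
  (b : 'rV[R]_m)
  (f_closed : forall i, closed_fun (f i))
  (f_proper : forall i, proper_fun (f i))
  (f_convex : forall i, convex_fun (f i))
  (A_nonzero : forall i, ~ (forall u, A i u = 0))
  (sol_nonunique : exists z w : blocks R d,
      [/\ z <> w, sumA A z = b & sumA A w = b])
  (A_onto : forall y : 'rV[R]_m, exists z : blocks R d, sumA A z = y)
  (xs : blocks R d) (ls : 'rV[R]_m) (hKKT : KKT_point f A b xs ls)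
  (eta : 'I_n -> R) (beta : nat -> R)
  (eta_gt : forall i, n%:R * opnorm (A i) ^+ 2 < eta i)
  (beta_gt0 : forall k, 0 < beta k)
  (beta_nd : nondecreasing_seq beta)
  (x : nat -> blocks R d) (lam : nat -> 'rV[R]_m)
  (hx : LADMPSAP f A b eta beta x lam)
  (K : nat) :
  let xbar := ergodic beta x K in
  (objective f xbar - objective f xs
   + (\sum_(i < n) dotv (adjoint (A i) ls) (xbar i - xs i))%:E
   + (alpha A eta * beta 0%N / 2 * enorm (sumA A xbar - b) ^+ 2)%:E
   <= (C0 eta beta x lam xs ls
       / (2 * \sum_(0 <= k < K.+1) (beta k)^-1))%:E)%E.
Proof.
cbv zeta; set xbar := ergodic beta x K; case: hKKT => Axs hs.
set S := \sum_(0 <= k < K.+1) (beta k)^-1.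
have betaV_gt0 k : 0 < (beta k)^-1 by rewrite invr_gt0.
have S_gt0 : 0 < S.
  by rewrite /S big_nat_recr //= ltr_wpDl // sumr_ge0 // => k _; rewrite ltW.
have eta_gt0 i : 0 < eta i.
  by apply: le_lt_trans (eta_gt i); rewrite mulr_ge0 ?sqr_ge0.
have sub k i := prox_subgradient (f_proper i) (f_convex i)
  (mulr_gt0 (eta_gt0 i) (beta_gt0 k)) ((hx k).1 i).
pose F k i := fine (f i (x k.+1 i)); pose Fs i := fine (f i (xs i)).
have FE k i : f i (x k.+1 i) = (F k i)%:E.
  by rewrite fineK // (subdifferential_fin_num (f_proper i) (sub k i)).
have FsE i : f i (xs i) = (Fs i)%:E.
  by rewrite fineK // (subdifferential_fin_num (f_proper i) (hs i)).
(* The gap at x^{k+1} of the Lagrangian with multiplier ls. *)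
pose gap k := \sum_i (F k i - Fs i)
              + \sum_i dotv (adjoint (A i) ls) (x k.+1 i - xs i).
pose rsq k := enorm (sumA A (x k.+1) - b) ^+ 2.
have total : \sum_(0 <= k < K.+1) ((beta k)^-1 * gap k + alpha A eta / 2 * rsq k)
    <= C0 eta beta x lam xs ls / 2.
  apply: (weighted_telescope beta_gt0 beta_nd
    (P := fun k => \sum_i eta i * enorm (x k i - xs i) ^+ 2)
    (D := fun k => enorm (lam k - ls) ^+ 2)) => k.
  - by apply: sumr_ge0 => i _; rewrite mulr_ge0 ?sqr_ge0 // ltW.
  - exact: sqr_ge0.
  apply: (@ladmpsap_step _ _ _ _ _ b eta eta_gt (x k) (x k.+1) xs (lam k)
    (lam k.+1) ls (beta k) (beta_gt0 k) (F k) Fs Axs _ (hx k).2) => i.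
  by have := sub k i (xs i); rewrite FE FsE -EFinD lee_fin.
have gapE : \sum_(0 <= k < K.+1) gamma beta K k * gap k =
    \sum_i \sum_(0 <= k < K.+1) gamma beta K k * F k i - \sum_i Fs i
    + \sum_i dotv (adjoint (A i) ls) (xbar i - xs i).
  have w1 := gamma_sum beta_gt0 K.
  rewrite -sumrB -big_split /=.
  under [LHS]eq_bigr do rewrite /gap -big_split mulr_sumr.
  rewrite exchange_big; apply: eq_bigr => i _ /=.
  rewrite /xbar /ergodic -(weighted_sumB w1 (fun k => x k.+1 i)).
  rewrite (dotvC (adjoint _ ls)) dotv_suml.
  (* R^o is R seen as a module over itself, so real averages are covered too. *)
  have /= <- := weighted_sumB w1 (fun k => F k i : R^o) (Fs i).
  rewrite -big_split; apply: eq_bigr => k _ /=.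
  by rewrite dotvZl (dotvC _ (adjoint _ _)) mulrDr.
have resE : enorm (sumA A xbar - b) ^+ 2 <=
    \sum_(0 <= k < K.+1) gamma beta K k * rsq k.
  rewrite sumA_ergodic -(weighted_sumB (gamma_sum beta_gt0 K)).
  rewrite -lee_fin.
  exact: (convex_jensen (@convex_sqr_enorm R m) betaV_gt0 (fun k => lexx _)).
have objE : (objective f xbar <=
    (\sum_i \sum_(0 <= k < K.+1) gamma beta K k * F k i)%:E)%E.
  rewrite -sumEFin; apply: lee_sum => i _.
  apply: (convex_jensen (f_convex i) betaV_gt0 (y := fun k => x k.+1 i)) => k.
  by rewrite FE.
have objsE : objective f xs = (\sum_i Fs i)%:E.
  by rewrite -sumEFin; apply: eq_bigr => i _.
rewrite objsE.
apply: (@le_trans _ _ (\sum_(0 <= k < K.+1) gamma beta K k * gap k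
   + alpha A eta * beta 0%N / 2 * enorm (sumA A xbar - b) ^+ 2)%:E).
  by rewrite gapE !EFinD EFinN !leeD2r.
rewrite lee_fin.
have gammaE G : \sum_(0 <= k < K.+1) gamma beta K k * G k =
    (\sum_(0 <= k < K.+1) (beta k)^-1 * G k) / S.
  by rewrite mulr_suml; apply: eq_bigr => k _; rewrite /gamma mulrAC.
have alpha_ge0 : 0 <= alpha A eta.
  by rewrite invr_ge0 mulr_ge0 // (le_trans ler01) // bigmax_ge_id.
have rsq_sum : beta 0%N * enorm (sumA A xbar - b) ^+ 2 <=
    (\sum_(0 <= k < K.+1) rsq k) / S.
  rewrite -ler_pdivlMl //; apply: le_trans resE _; rewrite gammaE mulrA.
  rewrite ler_pM2r ?invr_gt0 // mulr_sumr; apply: ler_sum => k _.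
  by rewrite ler_wpM2r ?sqr_ge0 // lef_pV2 ?posrE // beta_nd.
move: total; rewrite big_split -mulr_sumr /= gammaE => total.
apply: (@le_trans _ _ ((C0 eta beta x lam xs ls / 2) / S)); last first.
  by rewrite -mulrA -invfM.
apply: le_trans (_ : (\sum_(0 <= k < K.+1) (beta k)^-1 * gap k
   + alpha A eta / 2 * \sum_(0 <= k < K.+1) rsq k) / S <= _); last first.
  by rewrite ler_pM2r ?invr_gt0.
rewrite mulrDl lerD2l.
have -> : alpha A eta * beta 0%N / 2 * enorm (sumA A xbar - b) ^+ 2 =
    alpha A eta / 2 * (beta 0%N * enorm (sumA A xbar - b) ^+ 2) by ring.
by rewrite -[leRHS]mulrA ler_wpM2l // divr_ge0.
Qed.
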